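(* Let $A$ be a $*$-semiprime non-commutative associative algebra over $\Phi$ with involution $*$, such that $\deg(A/I)>2$ for every $*$-prime ideal $I$ of $A$. Then: (i) $\mathrm{SDer}(A)/I_{K,Z}$ is a strongly non-degenerate Lie algebra; (ii) if $Z(K)$ contains no non-zero associative $*$-ideals of $A$ (in particular, if $A$ is $*$-prime), then $\mathrm{SDer}(A)$ is a strongly non-degenerate Lie algebra.
   Context: $\Phi$ is a unital commutative ring in which $2$ and $3$ are invertible. $K=\{x\in A: x^*=-x\}$ is the Lie algebra of skew elements, $Z(K)$ its Lie center, $Z$ the center of $A$. $\mathrm{SDer}(A)=\{\delta\in\mathrm{Der}(A): \delta(x^* )=\delta(x)^*\ \forall x\in A\}$, a Lie subalgebra (under the commutator) of the Lie algebra $\mathrm{Der}(A)$ of associative derivations of $A$. $I_{K,Z}=\{\delta\in\mathrm{SDer}(A): \delta(K)\subseteq Z\}$. A $*$-ideal is an ideal $I$ with $I^*=I$; $A$ is $*$-prime ($*$-semiprime) if the product of any two non-zero $*$-ideals is non-zero (resp. $J^2\ne0$ for every non-zero $*$-ideal $J$); a $*$-ideal $I$ is $*$-prime if $A/I$ is $*$-prime. For a semiprime algebra $B$, its extended centroid $\mathcal C$ is the center of its two-sided (symmetric) ring of quotients; $\deg(x)$ is the degree of algebraicity of $x\in B$ over $\mathcal C$ ($\infty$ if not algebraic), and $\deg(B)=\sup_{x\in B}\deg(x)$. A Lie algebra $M$ is strongly non-degenerate if $[x,[x,M]]=0$ implies $x=0$. *)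

(* Defs.v *)
From HB Require Import structures.
From mathcomp Require Import all_boot all_order all_algebra.
Set Implicit Arguments. Unset Strict Implicit. Unset Printing Implicit Defensive.
Import GRing.Theory.
Local Open Scope ring_scope.

(* A (possibly non-unital) associative algebra over Phi: the carrier is a
   Phi-module A, the product mul is bilinear and associative, and star is an
   involution (Phi-linear, anti-multiplicative, involutive). Subsets of A are
   predicates A -> Prop. Quotients A/I are handled "modulo I". *)
Section StarAlgebra.
Variables (Phi : comNzRingType) (A : lmodType Phi).
Variables (mul : A -> A -> A) (star : A -> A).

Definition is_assoc_algebra : Prop :=
  [/\ (forall x y z, mul (x + y) z = mul x z + mul y z),
      (forall x y z, mul x (y + z) = mul x y + mul x z),
      (forall (a : Phi) x y, mul (a *: x) y = a *: mul x y),
      (forall (a : Phi) x y, mul x (a *: y) = a *: mul x y) &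
      (forall x y z, mul x (mul y z) = mul (mul x y) z)].

Definition is_involution : Prop :=
  [/\ (forall x y, star (x + y) = star x + star y),
      (forall (a : Phi) x, star (a *: x) = a *: star x),
      (forall x y, star (mul x y) = mul (star y) (star x)) &
      (forall x, star (star x) = x)].

Definition noncommutative : Prop := exists x y, mul x y <> mul y x.

Definition is_ideal (I : A -> Prop) : Prop :=
  [/\ I 0, (forall x y, I x -> I y -> I (x + y)),
      (forall (a : Phi) x, I x -> I (a *: x)),
      (forall a x, I x -> I (mul a x)) &
      (forall a x, I x -> I (mul x a))].

Definition is_star_ideal (I : A -> Prop) : Prop :=
  is_ideal I /\ (forall x, I x -> I (star x)).

Definition star_semiprime : Prop :=
  forall J, is_star_ideal J ->
    (forall x y, J x -> J y -> mul x y = 0) -> forall x, J x -> x = 0.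

(* I is a *-prime ideal: a proper *-ideal such that A/I is *-prime, i.e. the
   product of two *-ideals of A/I (= *-ideals of A containing I) is zero in
   A/I only if one of them is zero in A/I. *)
Definition star_prime_ideal (I : A -> Prop) : Prop :=
  [/\ is_star_ideal I, (exists x, ~ I x) &
      forall J1 J2, is_star_ideal J1 -> is_star_ideal J2 ->
        (forall x, I x -> J1 x) -> (forall x, I x -> J2 x) ->
        (forall x y, J1 x -> J2 y -> I (mul x y)) ->
        (forall x, J1 x -> I x) \/ (forall x, J2 x -> I x)].

(* J/I is an essential (dense) ideal of A/I: an ideal with zero left and right
   annihilators in A/I. *)
Definition dense_ideal_mod (I J : A -> Prop) : Prop :=
  [/\ is_ideal J, (forall x, I x -> J x),
      (forall x, (forall d, J d -> I (mul x d)) -> I x) &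
      (forall x, (forall d, J d -> I (mul d x)) -> I x)].

(* f induces an (A/I)-bimodule homomorphism J/I -> A/I.  Equivalence classes of
   such maps (on dense ideals) form the extended centroid C of A/I
   (= center of the symmetric Martindale ring of quotients). *)
Definition bimod_map_mod (I J : A -> Prop) (f : A -> A) : Prop :=
  [/\ (forall x, I x -> I (f x)),
      (forall x y, J x -> J y -> I (f (x + y) - f x - f y)),
      (forall x a, J x -> I (f (mul x a) - mul (f x) a)) &
      (forall x a, J x -> I (f (mul a x) - mul a (f x)))].

Definition lpow (x : A) (i : nat) (d : A) : A := iter i (mul x) d.

(* The image of x in A/I is a root of a monic polynomial
   t^m + lambda_(m-1) t^(m-1) + ... + lambda_0 with lambda_i in C:
   there is a common dense ideal J on which the lambda_i are represented by
   bimodule maps f i, and (x^m + sum_i lambda_i x^i) J = 0 in A/I. *)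
Definition root_monic_mod (I : A -> Prop) (m : nat) (x : A) : Prop :=
  exists (J : A -> Prop) (f : nat -> A -> A),
    [/\ dense_ideal_mod I J,
        (forall i, (i < m)%N -> bimod_map_mod I J (f i)) &
        forall d, J d ->
          I (lpow x m d + \sum_(i < m) f i (lpow x i d))].

Definition deg_le_mod (I : A -> Prop) (n : nat) (x : A) : Prop :=
  exists m, [/\ (0 < m)%N, (m <= n)%N & root_monic_mod I m x].

Definition deg_gt_mod (I : A -> Prop) (n : nat) : Prop :=
  exists x, ~ deg_le_mod I n x.

Definition skew (x : A) : Prop := star x = - x.
Definition central (x : A) : Prop := forall y, mul x y = mul y x.
Definition lie_center_K (x : A) : Prop :=
  skew x /\ forall k, skew k -> mul x k - mul k x = 0.

Definition is_sder (d : A -> A) : Prop :=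
  [/\ (forall x y, d (x + y) = d x + d y),
      (forall (a : Phi) x, d (a *: x) = a *: d x),
      (forall x y, d (mul x y) = mul (d x) y + mul x (d y)) &
      (forall x, d (star x) = star (d x))].

Definition in_IKZ (d : A -> A) : Prop :=
  is_sder d /\ forall k, skew k -> central (d k).

Definition lie_br (d e : A -> A) : A -> A := fun x => d (e x) - e (d x).

End StarAlgebra.

(* Main.v *)
(* Feeding inner derivations ad k to the hypothesis shows that a = d (d k)
   commutes with K modulo the center for every skew k. The degree condition
   makes the ideal generated by [K, K] faithful: on a *-prime quotient where the
   skew elements commute, a non-central skew a makes a^2 x^2 - a (a s + s a) x
   a central element for x = s + k, so every x would be quadratic over the
   extended centroid. Hence d^2 K is central. Then d kills the central
   elements, and d^3 (a k^2) = 0 with a = d^2 k forces a^3 = 0, so d^2 K = 0.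
   In this case all products (d k) (d h) vanish: they annihilate d^3 A, and
   modulo their annihilator d behaves like ad a with a^2 = 0 and a K a = 0, for
   which a x a y a z a is an alternating form that has to vanish. Finally
   b = d k satisfies b K b = 0, which forces b = 0, and a *-derivation killing K
   kills everything. Thus even d = 0 under the hypothesis of (i). *)
Require Import Defs.
From HB Require Import structures.
From mathcomp Require Import all_boot all_order all_algebra.
From mathcomp Require Import boolp classical_sets.
Set Implicit Arguments. Unset Strict Implicit. Unset Printing Implicit Defensive.
Import GRing.Theory.
Local Open Scope ring_scope.

(** * Identities in free associative rings *)

Section NcReflection.
Variables (Phi : comNzRingType) (A : lmodType Phi) (mul : A -> A -> A).
Hypothesis hA : is_assoc_algebra mul.

Lemma algDl x y z : mul (x + y) z = mul x z + mul y z.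
Proof. by case: hA. Qed.
Lemma algDr x y z : mul x (y + z) = mul x y + mul x z.
Proof. by case: hA. Qed.
Lemma algA x y z : mul x (mul y z) = mul (mul x y) z.
Proof. by case: hA. Qed.
Lemma alg0r x : mul x 0 = 0.
Proof. by apply: (addrI (mul x 0)); rewrite -algDr !addr0. Qed.
Lemma alg0l x : mul 0 x = 0.
Proof. by apply: (addrI (mul 0 x)); rewrite -algDl !addr0. Qed.
Lemma algNl x y : mul (- x) y = - mul x y.
Proof. by apply/eqP; rewrite -addr_eq0 -algDl addNr alg0l. Qed.
Lemma algNr x y : mul x (- y) = - mul x y.
Proof. by apply/eqP; rewrite -addr_eq0 -algDr addNr alg0r. Qed.

Inductive ncexpr :=
  | NVar of nat
  | NZero
  | NAdd of ncexpr & ncexpr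
  | NOpp of ncexpr
  | NMul of ncexpr & ncexpr
  | NMuln of ncexpr & nat.

Fixpoint nceval (env : seq A) (e : ncexpr) : A :=
  match e with
  | NVar i => nth 0 env i
  | NZero => 0
  | NAdd e1 e2 => nceval env e1 + nceval env e2
  | NOpp e1 => - nceval env e1
  | NMul e1 e2 => mul (nceval env e1) (nceval env e2)
  | NMuln e1 n => nceval env e1 *+ n
  end.

(* A signed non-empty word: the algebra has no unit to interpret the empty
   word. *)
Definition ncmonom : Type := bool * (nat * seq nat).

Fixpoint word_val (env : seq A) (i : nat) (w : seq nat) : A :=
  if w is j :: w' then mul (nth 0 env i) (word_val env j w') else nth 0 env i.

Definition monom_val env (m : ncmonom) : A :=
  let w := word_val env m.2.1 m.2.2 in if m.1 then - w else w.

Definition monoms_val env (p : seq ncmonom) : A := \sum_(m <- p) monom_val env m.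

Definition monom_opp (m : ncmonom) : ncmonom := (~~ m.1, m.2).
Definition monom_mul (m n : ncmonom) : ncmonom :=
  (m.1 (+) n.1, (m.2.1, m.2.2 ++ n.2.1 :: n.2.2)).

Fixpoint ncnorm (e : ncexpr) : seq ncmonom :=
  match e with
  | NVar i => [:: (false, (i, [::]))]
  | NZero => [::]
  | NAdd e1 e2 => ncnorm e1 ++ ncnorm e2
  | NOpp e1 => map monom_opp (ncnorm e1)
  | NMul e1 e2 => [seq monom_mul m n | m <- ncnorm e1, n <- ncnorm e2]
  | NMuln e1 n => iter n (cat (ncnorm e1)) [::]
  end.

(** Integer coefficients are encoded by repeating signed words, so cancelling opposite pairs decides
    whether a sum vanishes, without sorting. *)
Fixpoint insert_monom (m : ncmonom) (p : seq ncmonom) : seq ncmonom :=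
  if p is n :: p' then
    if (n.2 == m.2) && (n.1 != m.1) then p' else n :: insert_monom m p'
  else [:: m].

Lemma word_val_cat env i u j v :
  word_val env i (u ++ j :: v) = mul (word_val env i u) (word_val env j v).
Proof. by elim: u i => [|k u IHu] i //=; rewrite IHu algA. Qed.

Lemma monom_val_opp env m : monom_val env (monom_opp m) = - monom_val env m.
Proof. by case: m => [[] w]; rewrite /monom_val /= ?opprK. Qed.

Lemma monom_val_mul env m n :
  monom_val env (monom_mul m n) = mul (monom_val env m) (monom_val env n).
Proof.
case: m n => [[] [i u]] [[] [j v]];
by rewrite /monom_val /= word_val_cat ?algNl ?algNr ?opprK.
Qed.

Lemma monoms_val_norm env e : monoms_val env (ncnorm e) = nceval env e.
Proof.
rewrite /monoms_val; elim: e => /= [i||e1 IH1 e2 IH2|e1 IH1|e1 IH1 e2 IH2|e1 IH1 n].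
- by rewrite big_seq1.
- by rewrite big_nil.
- by rewrite big_cat /= IH1 IH2.
- rewrite big_map -IH1 -sumrN.
  by apply: eq_bigr => m _; rewrite monom_val_opp.
- rewrite -IH1 -IH2; elim: (ncnorm e1) => [|k p IHp] /=.
    by rewrite !big_nil alg0l.
  rewrite big_cat big_cons algDl /= -IHp big_map; congr (_ + _).
  elim: (ncnorm e2) => [|n q IHq]; first by rewrite !big_nil alg0r.
  by rewrite !big_cons IHq algDr monom_val_mul.
- elim: n => [|n IHn]; first by rewrite mulr0n big_nil.
  by rewrite iterS big_cat /= IHn IH1 mulrS.
Qed.

Lemma insert_monomE env m p :
  monoms_val env (insert_monom m p) = monom_val env m + monoms_val env p.
Proof.
rewrite /monoms_val; elim: p => [|n p IHp] /=; first by rewrite big_seq1 big_nil addr0.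
case: ifP => [/andP[/eqP enm snm]|_]; last by rewrite !big_cons IHp addrCA.
rewrite big_cons addrA [X in X + _](_ : _ = 0) ?add0r //.
by case: n m {IHp} enm snm => [[] w] [[] v] //= <- _; rewrite /monom_val /= ?addNr ?addrN.
Qed.

Lemma ncring_correct env e1 e2 :
  nilp (foldr insert_monom [::] (ncnorm (NAdd e1 (NOpp e2)))) ->
  nceval env e1 = nceval env e2.
Proof.
move=> /nilP h; apply/eqP; rewrite -subr_eq0; apply/eqP.
rewrite -[LHS](monoms_val_norm env (NAdd e1 (NOpp e2))).
have hins p : monoms_val env p = monoms_val env (foldr insert_monom [::] p).
  elim: p => //= m p IHp; rewrite insert_monomE -IHp.
  by rewrite /monoms_val big_cons.
by rewrite hins h /monoms_val big_nil.
Qed.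

End NcReflection.

Ltac nc_mem x env :=
  lazymatch env with
  | nil => false
  | cons ?y ?env' =>
      match constr:(Set) with
      | _ => let _ := match constr:(Set) with _ => constr_eq x y end in true
      | _ => nc_mem x env'
      end
  end.

Ltac nc_index x env :=
  lazymatch env with
  | cons ?y ?env' =>
      match constr:(Set) with
      | _ => let _ := match constr:(Set) with _ => constr_eq x y end in constr:(0%N)
      | _ => let n := nc_index x env' in constr:(S n)
      end
  end.

Ltac nc_atoms mul t env :=
  lazymatch t with
  | (?x + ?y)%R => let env := nc_atoms mul x env in nc_atoms mul y env
  | (- ?x)%R => nc_atoms mul x env
  | mul ?x ?y => let env := nc_atoms mul x env in nc_atoms mul y env
  | (?x *+ ?n)%R => nc_atoms mul x env
  | 0%R => env
  | _ => let b := nc_mem t env in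
         lazymatch b with true => env | false => constr:(cons t env) end
  end.

Ltac nc_quote mul t env :=
  lazymatch t with
  | (?x + ?y)%R =>
      let x := nc_quote mul x env in let y := nc_quote mul y env in
      constr:(NAdd x y)
  | (- ?x)%R => let x := nc_quote mul x env in constr:(NOpp x)
  | mul ?x ?y =>
      let x := nc_quote mul x env in let y := nc_quote mul y env in
      constr:(NMul x y)
  | (?x *+ ?n)%R => let x := nc_quote mul x env in constr:(NMuln x n)
  | 0%R => constr:(NZero)
  | _ => let n := nc_index t env in constr:(NVar n)
  end.

(* Decides equalities that hold in the free non-unital associative ring. *)
Ltac ncring :=
  match goal with
  | hA : @is_assoc_algebra ?Phi ?A ?mul |- ?x = ?y =>
      let env := nc_atoms mul x constr:(@nil A) in
      let env := nc_atoms mul y env in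
      let e1 := nc_quote mul x env in
      let e2 := nc_quote mul y env in
      exact (@ncring_correct Phi A mul hA env e1 e2 (erefl true))
  end.

(** * Ideals and *-prime ideals *)

Section Ideals.
Variables (Phi : comNzRingType) (A : lmodType Phi) (mul : A -> A -> A).
Hypothesis hA : is_assoc_algebra mul.
Variable W : A -> Prop.
Hypothesis hW : is_ideal mul W.

Lemma ideal0 : W 0. Proof. by case: hW. Qed.
Lemma idealD x y : W x -> W y -> W (x + y). Proof. by case: hW => _ h *; apply: h. Qed.
Lemma idealZ a x : W x -> W (a *: x). Proof. by case: hW => _ _ h *; apply: h. Qed.
Lemma idealMl a x : W x -> W (mul a x). Proof. by case: hW => _ _ _ h *; apply: h. Qed.
Lemma idealMr a x : W x -> W (mul x a). Proof. by case: hW => _ _ _ _ h *; apply: h. Qed.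
Lemma idealN x : W x -> W (- x). Proof. by rewrite -scaleN1r; apply: idealZ. Qed.
Lemma idealMn n x : W x -> W (x *+ n). Proof. by rewrite -scaler_nat; apply: idealZ. Qed.

Lemma ideal_eq x y : x = y -> W (x - y).
Proof. by move=> ->; rewrite subrr; apply: ideal0. Qed.

Lemma ideal_divn (n : nat) x :
  (exists u : Phi, u * n%:R = 1) -> W (x *+ n) -> W x.
Proof. by case=> u hu /(idealZ u); rewrite -scaler_nat scalerA hu scale1r. Qed.

Definition semiprime_mod := forall c, (forall x, W (mul (mul c x) c)) -> W c.
End Ideals.

Lemma zero_ideal (Phi : comNzRingType) (A : lmodType Phi) (mul : A -> A -> A) :
  is_assoc_algebra mul -> is_ideal mul (fun x => x = 0).
Proof.
move=> hA; split=> //= [x y -> ->|a x ->|a x ->|a x ->].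
- by rewrite addr0.
- by rewrite scaler0.
- exact: alg0r.
- exact: alg0l.
Qed.

Lemma mulrn_eq0 (Phi : comNzRingType) (A : lmodType Phi) (n : nat) (x : A) :
  (exists u : Phi, u * n%:R = 1) -> x *+ n = 0 -> x = 0.
Proof.
by case=> u hu h; rewrite -[x]scale1r -hu -scalerA scaler_nat h scaler0.
Qed.

Ltac ideal_leaf :=
  solve [ auto
        | match goal with
          | H : central _ ?x |- _ ?x ?y = _ ?y ?x => exact (H y)
          | H : central _ ?x |- _ ?y ?x = _ ?x ?y => exact (esym (H y))
          end ].

Ltac ideal_mem hA hW :=
  first
  [ ideal_leaf
  | exact (ideal0 hW)
  | apply (idealN hW); ideal_mem hA hW
  | apply (idealMn hW); ideal_mem hA hW
  | apply (idealD hW); ideal_mem hA hW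
  | apply (idealMl hW); ideal_mem hA hW
  | apply (idealMr hW); ideal_mem hA hW ].

(* Proves membership in an ideal (resp. an equality) from a combination e of
   known members (resp. of differences of known equal elements). *)
Ltac ideal_comb hW e :=
  match goal with
  | hA : is_assoc_algebra _ |- ?W ?x =>
      refine (@eq_ind_r _ e W _ x _); [ideal_mem hA hW | ncring]
  end.

Lemma eq_comb (Phi : comNzRingType) (A : lmodType Phi) (e x y : A) :
  e = 0 -> x - y = e -> x = y.
Proof. by move=> -> /eqP; rewrite subr_eq0 => /eqP. Qed.

Ltac zero_mem hA :=
  first
  [ ideal_leaf
  | reflexivity
  | apply (ideal_eq (zero_ideal hA)); ideal_leaf
  | apply (idealN (zero_ideal hA)); zero_mem hA
  | apply (idealMn (zero_ideal hA)); zero_mem hA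
  | apply (idealD (zero_ideal hA)); zero_mem hA
  | apply (idealMl (zero_ideal hA)); zero_mem hA
  | apply (idealMr (zero_ideal hA)); zero_mem hA ].

Ltac eq_lincomb e :=
  match goal with
  | hA : is_assoc_algebra _ |- ?x = ?y =>
      refine (@eq_comb _ _ e x y _ _); [zero_mem hA | ncring]
  end.

(** * Semiprimeness and primeness relative to the involution *)

Section Involution.
Variables (Phi : comNzRingType) (A : lmodType Phi).
Variables (mul : A -> A -> A) (star : A -> A).
Hypotheses (hA : is_assoc_algebra mul) (hstar : is_involution mul star).
Local Notation "x ** y" := (mul x y) (at level 40, left associativity).
Local Notation "x ^*" := (star x) : ring_scope.
Local Notation skew := (Defs.skew star).

Lemma starD x y : (x + y)^* = x^* + y^*. Proof. by case: hstar. Qed.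
Lemma starM x y : (x ** y)^* = y^* ** x^*. Proof. by case: hstar. Qed.
Lemma starK x : x^*^* = x. Proof. by case: hstar. Qed.
Lemma starN x : (- x)^* = - x^*.
Proof. by case: hstar => _ h _ _; rewrite -scaleN1r h scaleN1r. Qed.
Lemma star0 : 0^* = 0.
Proof. by rewrite -[in LHS](scale0r 0); case: hstar => _ -> _ _; rewrite scale0r. Qed.
Definition starE := (starD, starM, starN, starK, star0).

Lemma skew_sub x : skew (x - x^*).
Proof. by rewrite /Defs.skew !starE; ncring. Qed.

Lemma sym_add x : (x + x^*)^* = x + x^*.
Proof. by rewrite !starE; ncring. Qed.

Lemma sym_skew_ind (P : A -> Prop) :
    (exists u : Phi, u * 2%:R = 1) ->
    (forall x y, P x -> P y -> P (x + y)) ->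
    (forall a x, P x -> P (a *: x)) ->
  (forall s, s^* = s -> P s) -> (forall k, skew k -> P k) -> forall x, P x.
Proof.
case=> u hu hD hZ hs hk x.
suff -> : x = u *: ((x + x^*) + (x - x^*)).
  by apply/hZ/hD; [apply: hs; apply: sym_add|apply: hk; apply: skew_sub].
rewrite (_ : _ + _ = x *+ 2); last by ncring.
by rewrite -scaler_nat scalerA hu scale1r.
Qed.

Definition star_semiprime_mod (W : A -> Prop) :=
  forall J, is_star_ideal mul star J -> (forall x, W x -> J x) ->
    (forall x y, J x -> J y -> W (x ** y)) -> forall x, J x -> W x.

Lemma zero_star_ideal : is_star_ideal mul star (fun x => x = 0).
Proof. by split=> [|x ->]; [apply: zero_ideal|apply: star0]. Qed.

Lemma star_ideal_split (J : A -> Prop) :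
  J 0 -> (forall x y, J x -> J y -> J (x + y)) ->
  (forall (a : Phi) x, J x -> J (a *: x)) ->
  (forall a x, J x -> J (a ** x)) -> (forall x, J x -> J (x^*)) ->
  is_star_ideal mul star J.
Proof.
move=> h0 hD hZ hM hs; split=> //; split=> // a x /hs jx.
by rewrite -[x ** a]starK starM; apply/hs/hM.
Qed.

Lemma algZl (a : Phi) x y : (a *: x) ** y = a *: (x ** y). Proof. by case: hA. Qed.
Lemma algZr (a : Phi) x y : x ** (a *: y) = a *: (x ** y). Proof. by case: hA. Qed.
Lemma starZ (a : Phi) x : (a *: x)^* = a *: x^*. Proof. by case: hstar. Qed.
Definition algE := (algDl hA, algDr hA, algZl, algZr, alg0l hA, alg0r hA, starE, starZ).

Section ModStarIdeal.
Variable W : A -> Prop.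
Hypothesis hW : is_star_ideal mul star W.
Let hWi : is_ideal mul W := proj1 hW.
Let hWs x : W x -> W (x^*). Proof. by apply: (proj2 hW). Qed.
Let hD := idealD hWi.
Let hZ := idealZ hWi.
Let hl := idealMl hWi.
Let hr := idealMr hWi.
Let h0 := ideal0 hWi.

Lemma ideal_starE x : W (x^*) -> W x.
Proof. by move/hWs; rewrite starK. Qed.

Hypothesis hsp : star_semiprime_mod W.

(** For lack of a unit, the *-ideal J generated by W and w is only seen to satisfy J A J ⊆ W. So
    *-semiprimeness is used twice: the two-sided annihilator of J in J modulo W lies in W, it
    contains J J, and hence J lies in W. *)
Let star_square_zero w :
  (forall y, W (w ** y ** w)) -> (forall y, W (w^* ** y ** w)) ->
  (forall y, W (w ** y ** w^*)) -> W w.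
Proof.
move=> h1 h2 h3.
have h4 y : W (w^* ** y ** w^*).
  by apply: ideal_starE; rewrite !starE (algA hA); apply: h1.
(* J is an intersection, so a property of its members is proved by taking for [L] the elements
   having that property. *)
pose J x := forall L, is_star_ideal mul star L -> (forall z, W z -> L z) -> L w -> L x.
have Jw : J w by move=> L _ _.
have WJ x : W x -> J x by move=> wx L _ hL _; apply: hL.
have hJ : is_star_ideal mul star J.
  split; first split=> [L [[]]|x y jx jy L hL *|a x jx L hL *|a x jx L hL *|a x jx L hL *] //.
  - by apply: (idealD (proj1 hL)); [apply: jx|apply: jy].
  - by apply: (idealZ (proj1 hL)); apply: jx.
  - by apply: (idealMl (proj1 hL)); apply: jx.
  - by apply: (idealMr (proj1 hL)); apply: jx.
  - by move=> x jx L hL *; apply: (proj2 hL); apply: jx.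
have wJ x : J x -> forall y, [/\ W (w ** y ** x), W (w^* ** y ** x),
    W (w ** y ** x^*) & W (w^* ** y ** x^*)].
  move/(_ (fun x => forall y, [/\ W (w ** y ** x), W (w^* ** y ** x),
    W (w ** y ** x^*) & W (w^* ** y ** x^*)])); apply=> [|z wz y|y].
  - apply: star_ideal_split => [y|u v hu hv y|a u hu y|a u hu y|u hu y].
    + by rewrite !algE; split; apply: h0.
    + by case: (hu y) => *; case: (hv y) => *; rewrite !algE; split; apply: hD.
    + by case: (hu y) => *; rewrite !algE; split; apply: hZ.
    + case: (hu (y ** a)) => h1u h2u _ _; case: (hu y) => _ _ h3u h4u.
      by rewrite !starE !(algA hA) in h1u h2u *; split=> //; apply: hr.
    + by case: (hu y) => *; rewrite !starE; split.
  - by split; apply: hl => //; apply: hWs.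
  - by split.
have JJ x : J x -> forall z y, J z -> W (x ** y ** z) /\ W (x^* ** y ** z).
  move/(_ (fun x => forall z y, J z -> W (x ** y ** z) /\ W (x^* ** y ** z))).
  apply=> [|u wu z y jz|z y jz].
  - apply: star_ideal_split => [z y jz|u v hu hv z y jz|a u hu z y jz|a u hu z y jz|u hu z y jz].
    + by rewrite !algE; split; apply: h0.
    + by case: (hu z y jz) => *; case: (hv z y jz) => *; rewrite !algE; split; apply: hD.
    + by case: (hu z y jz) => *; rewrite !algE; split; apply: hZ.
    + case: (hu z y jz) => + _; case: (hu z (a^* ** y) jz) => _.
      move=> *; rewrite !starE -!(algA hA); split;
        last by rewrite !(algA hA) -!(algA hA) (algA hA a^*) (algA hA).
      by apply: hl; rewrite (algA hA).
    + by case: (hu z y jz) => *; rewrite starK.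
  - by split; do 2 apply: hr => //; apply: hWs.
  - by case: (wJ z jz y).
pose J3 x := [/\ J x, forall y, J y -> W (x ** y) & forall y, J y -> W (y ** x)].
have J3W x : J3 x -> W x.
  apply: (hsp (J := J3)) => [|z wz|z t [jz jzz zjz] [jt _ _]].
  - apply: star_ideal_split => [|u v [ju u1 u2] [jv v1 v2]|a u [ju u1 u2]|a u [ju u1 u2]|u [ju u1 u2]].
    + by split=> [|y _|y _]; rewrite ?(alg0l hA) ?(alg0r hA) //; apply: (ideal0 (proj1 hJ)).
    + split=> [|y jy|y jy]; rewrite ?(algDl hA) ?(algDr hA).
      * by apply: (idealD (proj1 hJ)).
      * by apply: hD; auto.
      * by apply: hD; auto.
    + split=> [|y jy|y jy]; rewrite ?algZl ?algZr.
      * by apply: (idealZ (proj1 hJ)).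
      * by apply: hZ; auto.
      * by apply: hZ; auto.
    + split=> [|y jy|y jy].
      * by apply: (idealMl (proj1 hJ)).
      * by rewrite -(algA hA); apply/hl/u1.
      * by rewrite (algA hA); apply: u2; apply: (idealMr (proj1 hJ)).
    + split=> [|y jy|y jy]; first by apply: (proj2 hJ).
      * by apply: ideal_starE; rewrite !starE; apply: u2; apply: (proj2 hJ).
      * by apply: ideal_starE; rewrite !starE; apply: u1; apply: (proj2 hJ).
  - by split=> [|y _|y _]; [apply: WJ|apply: hr|apply: hl].
  - exact: jzz.
apply: (hsp hJ WJ _ Jw) => x y jx jy; apply: J3W; split.
- by apply: (idealMr (proj1 hJ)).
- by move=> z jz; case: (JJ x jx z y jz).
- by move=> z jz; rewrite (algA hA); case: (JJ z jz y x jy).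
Qed.

(** [star_square_zero] is applied to c y c^*, then to c^* y c, finally to c: each time the required
    products contain a factor already known to lie in W. *)
Lemma star_semiprime_modP : semiprime_mod mul W.
Proof.
move=> c hc.
have h1 y : W (c ** y ** c^*).
  apply: star_square_zero => x; rewrite ?starE.
  - ideal_comb hWi ((c ** (y ** c^* ** x) ** c) ** y ** c^*).
  - ideal_comb hWi (c ** (y^* ** c^* ** x) ** c ** y ** c^*).
  - ideal_comb hWi (c ** (y ** c^* ** x) ** c ** y^* ** c^*).
have h2 y : W (c^* ** y ** c).
  apply: star_square_zero => x; rewrite ?starE.
  - ideal_comb hWi (c^* ** y ** (c ** x ** c^*) ** y ** c).
  - ideal_comb hWi (c^* ** y^* ** (c ** x ** c^*) ** y ** c).
  - ideal_comb hWi (c^* ** y ** (c ** x ** c^*) ** y^* ** c).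
exact: star_square_zero.
Qed.

End ModStarIdeal.

Lemma star_prime_ideal_semiprime I :
  star_prime_ideal mul star I -> semiprime_mod mul I.
Proof.
move=> [hI _ hp]; apply: star_semiprime_modP => // J hJ IJ JJ x jx.
by case: (hp J J hJ hJ IJ IJ JJ) => h; apply: h.
Qed.

(** The largest *-ideal J with u A J ⊆ I contains v. The *-ideal annihilating J from the left modulo
    I contains A u A, as u is symmetric or skew. Primeness puts one of the two into I. *)
Lemma star_prime_ideal_elt I u v :
  star_prime_ideal mul star I -> u^* = u \/ u^* = - u ->
  (forall x, I (u ** x ** v)) -> (forall x, I (u ** x ** v^*)) -> I u \/ I v.
Proof.
move=> pI hu uv uvs; have sI := star_prime_ideal_semiprime pI.
case: pI => hI _ hp; have hIi := proj1 hI.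
pose J x := forall y, I (u ** y ** x) /\ I (u ** y ** x^*).
have hJ : is_star_ideal mul star J.
  apply: star_ideal_split => [y|x z hx hz y|a x hx y|a x hx y|x hx y].
  - by rewrite !algE; split; apply: (ideal0 hIi).
  - by case: (hx y) => *; case: (hz y) => *; rewrite !algE; split; apply: (idealD hIi).
  - by case: (hx y) => *; rewrite !algE; split; apply: (idealZ hIi).
  - rewrite starM !(algA hA); split; last by apply: (idealMr hIi); case: (hx y).
    by rewrite -(algA hA u y a); case: (hx (y ** a)).
  - by rewrite starK; case: (hx y).
pose L x := forall t, J t -> I (x ** t) /\ I (x^* ** t).
have hL : is_star_ideal mul star L.
  apply: star_ideal_split => [t jt|x z hx hz t jt|a x hx t jt|a x hx t jt|x hx t jt].
  - by rewrite !algE; split; apply: (ideal0 hIi).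
  - by case: (hx t jt) => *; case: (hz t jt) => *; rewrite !algE; split; apply: (idealD hIi).
  - by case: (hx t jt) => *; rewrite !algE; split; apply: (idealZ hIi).
  - rewrite starM -!(algA hA); split; first by apply: (idealMl hIi); case: (hx t jt).
    by have [] := hx (a^* ** t) (idealMl (proj1 hJ) _ jt).
  - by rewrite starK; case: (hx t jt).
have [|||LI|JI] := hp L J hL hJ.
- by move=> x ix t _; split; apply: (idealMr hIi) => //; apply: (proj2 hI).
- by move=> x ix y; split; apply: (idealMl hIi) => //; apply: (proj2 hI).
- by move=> x t hx jt; case: (hx t jt).
- left; apply: (sI _) => y; apply: (sI _) => z.
  suff h : I ((y ** u ** z) ** (u ** y ** u)) by ideal_comb hIi (u ** ((y ** u ** z) ** (u ** y ** u))).
  apply: (idealMr hIi); apply: LI => t jt; rewrite !starE.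
  have hj s : I (u ** s ** t) by case: (jt s).
  split; first by ideal_comb hIi (y ** (u ** z ** t)).
  case: hu => ->; first by ideal_comb hIi (z^* ** (u ** y^* ** t)).
  by ideal_comb hIi (- (z^* ** (u ** y^* ** t))).
- by right; apply: JI.
Qed.

Lemma star_semiprime_elt : star_semiprime mul star ->
  forall c, (forall x, c ** x ** c = 0) -> c = 0.
Proof.
move=> hsemi; apply: (star_semiprime_modP zero_star_ideal) => J hJ _.
exact: hsemi.
Qed.

(** The sequence [s] starts at c and never vanishes, by semiprimeness. An ideal containing one term
    contains all later ones, so a *-ideal maximal among those missing every term is *-prime. *)
Lemma star_prime_avoid c :
  star_semiprime mul star -> c <> 0 -> exists I, star_prime_ideal mul star I /\ ~ I c.
Proof.
move=> hsemi c0.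
have sp0 := star_semiprime_elt hsemi.
have /choice[g gP] : forall x, exists y, x <> 0 -> x ** y ** x <> 0.
  move=> x; case: (pselect (exists y, x ** y ** x <> 0)) => [[y hy]|hn].
    by exists y.
  exists 0 => x0; exfalso; apply: x0; apply: sp0 => y.
  by apply: contrapT => hy; apply: hn; exists y.
pose s n := iter n (fun x => x ** g x ** x) c.
have s0 n : s n <> 0 by elim: n => //= n IHn; apply: gP.
have sI (J : A -> Prop) m n : is_ideal mul J -> (m <= n)%N -> J (s m) -> J (s n).
  move=> hJ /subnK <-; elim: (n - m)%N => //= k IHk /IHk.
  by rewrite -/(s _); apply: (idealMl hJ).
(* Adjoining 0 turns the union of the empty chain into the zero ideal. *)
pose with0 (X : set A) x := x = 0 \/ X x.
pose P (X : set A) := is_star_ideal mul star (with0 X) /\ forall n, ~ X (s n).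
have [F FP Ftot|X [[hX Xs] Xmax]] := @Zorn_bigcup A P.
  split; last by move=> n [X /FP[_]]; apply.
  have Fsub x y : with0 (\bigcup_(X in F) X)%classic x -> with0 (\bigcup_(X in F) X)%classic y ->
      (x = 0 /\ y = 0) \/ exists X, [/\ F X, with0 X x & with0 X y].
    case=> [->|[X FX Xx]] [->|[Y FY Yy]]; first by left.
    - by right; exists Y; split=> //; [left|right].
    - by right; exists X; split=> //; [right|left].
    - right; case: (Ftot X Y FX FY) => h.
        by exists Y; split=> //; right=> //; apply: h.
      by exists X; split=> //; right=> //; apply: h.
  have Fin X x : F X -> with0 X x -> with0 (\bigcup_(X in F) X)%classic x.
    by move=> FX [->|Xx]; [left|right; exists X].
  apply: star_ideal_split => [|x y hx hy|a x hx|a x hx|x hx]; first by left.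
  - case: (Fsub x y hx hy) => [[-> ->]|[X [FX Xx Xy]]]; first by left; rewrite addr0.
    by apply: (Fin X) => //; apply: (idealD (proj1 (proj1 (FP X FX)))).
  - case: (Fsub x x hx hx) => [[-> _]|[X [FX Xx _]]]; first by left; rewrite scaler0.
    by apply: (Fin X) => //; apply: (idealZ (proj1 (proj1 (FP X FX)))).
  - case: (Fsub x x hx hx) => [[-> _]|[X [FX Xx _]]]; first by left; rewrite alg0r.
    by apply: (Fin X) => //; apply: (idealMl (proj1 (proj1 (FP X FX)))).
  - case: (Fsub x x hx hx) => [[-> _]|[X [FX Xx _]]]; first by left; rewrite star0.
    by apply: (Fin X) => //; apply: (proj2 (proj1 (FP X FX))).
have X's n : ~ with0 X (s n) by case=> [/s0|/Xs].
exists (with0 X); split; last exact: (X's 0%N).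
split=> //; first by exists c; apply: (X's 0%N).
have meets J : is_star_ideal mul star J -> (forall x, with0 X x -> J x) ->
    ~ (forall x, J x -> with0 X x) -> exists n, J (s n).
  move=> hJ XJ nJ; apply: contrapT => hn; apply: (Xmax J).
    split; first by move=> x Xx; apply: XJ; right.
    move=> /= JX; apply: nJ => x jx; right; exact: JX.
  split; last by move=> n jn; apply: hn; exists n.
  rewrite (_ : with0 J = J) //; apply/funext => x; apply/propext.
  by split; [case=> // ->; apply: (ideal0 (proj1 hJ))|right].
move=> J1 J2 hJ1 hJ2 XJ1 XJ2 JJ; apply: contrapT => /not_orP[n1 n2].
have [m hm] := meets J1 hJ1 XJ1 n1; have [n hn] := meets J2 hJ2 XJ2 n2.
(* With k = [maxn m n], the term s (k + 1) is the product of s k ** g (s k), in J1, and s k, in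
   J2. *)
apply: (X's (maxn m n).+1) => /=; apply: JJ.
  by apply: (idealMr (proj1 hJ1)); apply: (sI _ m) => //; [case: hJ1|apply: leq_maxl].
by apply: (sI _ n) => //; [case: hJ2|apply: leq_maxr].
Qed.

End Involution.

(** * Quotients in which skew elements commute *)

Section LowDegree.
Variables (Phi : comNzRingType) (A : lmodType Phi).
Variables (mul : A -> A -> A) (star : A -> A).
Hypotheses (h2 : exists u : Phi, u * 2%:R = 1).
Hypotheses (hA : is_assoc_algebra mul) (hstar : is_involution mul star).
Local Notation "x ** y" := (mul x y) (at level 40, left associativity).
Local Notation "x ^*" := (star x) : ring_scope.
Local Notation skew := (Defs.skew star).
Let stE := starE hstar.

Lemma skew_jordan k s : skew k -> s^* = s -> skew (k ** s + s ** k).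
Proof. by rewrite /Defs.skew !stE => -> ->; ncring. Qed.

Lemma sym_skew_decomp x : exists s k, [/\ s^* = s, skew k & x = s + k].
Proof.
apply: (sym_skew_ind (P := fun x => exists s k, [/\ s^* = s, skew k & x = s + k]) hA hstar h2).
- move=> _ _ [s [k [hs hk ->]]] [t [l [ht hl ->]]]; exists (s + t), (k + l).
  by rewrite /Defs.skew !stE hs ht hk hl; split=> //; ncring.
- move=> c _ [s [k [hs hk ->]]]; exists (c *: s), (c *: k).
  by rewrite /Defs.skew !(starZ hstar) hs hk scalerDr scalerN.
- by move=> s hs; exists s, 0; rewrite /Defs.skew !stE oppr0 addr0.
- by move=> k hk; exists 0, k; rewrite !stE add0r.
Qed.

Variable I : A -> Prop.
Hypothesis pI : star_prime_ideal mul star I.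
Let sI : semiprime_mod mul I := star_prime_ideal_semiprime hA hstar pI.
Let hIs x : I x -> I (x^*). Proof. by case: pI => [[_ h] _ _]; apply: h. Qed.
Let hI : is_ideal mul I. Proof. by case: pI => [[]]. Qed.

Definition central_mod z := forall x, I (z ** x - x ** z).

Lemma central_mod_ind z :
  (forall s, s^* = s -> I (z ** s - s ** z)) ->
  (forall k, skew k -> I (z ** k - k ** z)) -> central_mod z.
Proof.
move=> hs hk x; have [s [k [ss sk ->]]] := sym_skew_decomp x.
have := hs s ss; have := hk k sk => h1 h2'.
ideal_comb hI ((z ** s - s ** z) + (z ** k - k ** z)).
Qed.

Lemma central_modM y z : central_mod y -> central_mod z -> central_mod (y ** z).
Proof.
by move=> hy hz x; ideal_comb hI (y ** (z ** x - x ** z) + (y ** x - x ** y) ** z).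
Qed.

(** Centrality turns z v ∈ I into z A v ⊆ I, and likewise for v^*. The symmetry condition on z
    matters: a *-prime quotient can have central zero divisors. *)
Lemma central_mod_regular z v : z^* = z \/ z^* = - z ->
  central_mod z -> ~ I z -> I (z ** v) -> I v.
Proof.
move=> sz cz nz zv.
have vz : I (v^* ** z).
  have := hIs zv; rewrite stE; case: sz => -> // h.
  by ideal_comb hI (- (v^* ** - z)).
have [||//|//] := star_prime_ideal_elt hA hstar (v := v) pI sz.
- move=> x; ideal_comb hI ((z ** x - x ** z) ** v + x ** (z ** v)).
- move=> x; ideal_comb hI ((z ** (x ** v^*) - (x ** v^*) ** z) + x ** (v^* ** z)).
Qed.

Lemma commutative_deg_le1 :
  (forall x y, I (x ** y - y ** x)) -> forall x, deg_le_mod mul I 2 x.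
Proof.
move=> hc x; exists 1%N; split=> //.
exists (fun _ => True), (fun _ y => - (x ** y)); split.
- split=> // y hy; apply: (sI _) => z; last exact: hy.
  by rewrite -(algA hA); apply: hy.
- move=> i _; split=> [y iy|y z _ _|y z _|y z _].
  + ideal_comb hI (- (x ** y)).
  + ideal_comb hI (0 : A).
  + ideal_comb hI (0 : A).
  + ideal_comb hI (- ((x ** z - z ** x) ** y)).
- move=> d _; rewrite big_ord1 /=; ideal_comb hI (0 : A).
Qed.

(** If K ⊆ I, the involution is trivial modulo I and reverses products. Otherwise some central skew
    k is outside I; for symmetric s the skew element k s + s k is central and congruent to 2 k s,
    and k can be cancelled. *)
Lemma skew_central_commutative :
  (forall k, skew k -> central_mod k) -> forall x y, I (x ** y - y ** x).
Proof.
move=> hK; have [[k [sk nk]]|hn] := pselect (exists k, skew k /\ ~ I k); last first.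
  have {}hK z : I (z - z^*).
    apply: contrapT => nz; apply: hn; exists (z - z^*); split=> //.
    exact: (skew_sub hA hstar).
  move=> x y; have := hK (y ** x); rewrite stE => h.
  ideal_comb hI ((x - x^*) ** y + x^* ** (y - y^*) - (y ** x - x^* ** y^*)).
suff cs s : s^* = s -> central_mod s.
  move=> x; apply: central_mod_ind => [s /cs h|l /hK h].
    ideal_comb hI (- (s ** x - x ** s)).
  ideal_comb hI (- (l ** x - x ** l)).
move=> ss x; have ck := hK k sk; have cks := hK _ (skew_jordan sk ss).
apply: (central_mod_regular (z := k)) => //; first by right.
apply: (ideal_divn hI h2).
ideal_comb hI (((k ** s + s ** k) ** x - x ** (k ** s + s ** k)) + (k ** s - s ** k) ** x
  - (k ** x - x ** k) ** s - (k ** (x ** s) - (x ** s) ** k)).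
Qed.

(** The coefficients -tau/alpha and beta/alpha of the monic polynomial are realised on the dense
    ideal alpha A + I, where [q] is division by alpha, unique modulo I. *)
Lemma central_quadratic_root x alpha tau beta :
  alpha^* = alpha -> ~ I alpha ->
  central_mod alpha -> central_mod tau -> central_mod beta ->
  I (alpha ** x ** x - tau ** x + beta) -> root_monic_mod mul I 2 x.
Proof.
move=> sa na ca ct cb hx.
have reg v : I (alpha ** v) -> I v by apply: (central_mod_regular (or_introl _) _ _).
pose J y := exists d, I (alpha ** d - y).
have /choice[q qP] : forall y, exists d, J y -> I (alpha ** d - y).
  move=> y; have [[d hd]|n] := pselect (J y); first by exists d.
  by exists 0 => /n.
have qE y d : I (alpha ** d - y) -> I (q y - d).
  move=> h; apply: reg; have h' : I (alpha ** q y - y) by apply: qP; exists d.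
  ideal_comb hI ((alpha ** q y - y) - (alpha ** d - y)).
have bim z : central_mod z -> bimod_map_mod mul I J (fun y => z ** q y).
  move=> cz; split=> [y iy|y t /qP hy /qP ht|y t /qP hy|y t /qP hy].
  - have : I (q y - 0) by apply: qE; ideal_comb hI (- y).
    by rewrite subr0; apply: (idealMl hI).
  - have h : I (q (y + t) - (q y + q t)).
      by apply: qE; ideal_comb hI ((alpha ** q y - y) + (alpha ** q t - t)).
    ideal_comb hI (z ** (q (y + t) - (q y + q t))).
  - have h : I (q (y ** t) - q y ** t).
      by apply: qE; ideal_comb hI ((alpha ** q y - y) ** t).
    ideal_comb hI (z ** (q (y ** t) - q y ** t)).
  - have h : I (q (t ** y) - t ** q y).
      by apply: qE; ideal_comb hI ((alpha ** t - t ** alpha) ** q y + t ** (alpha ** q y - y)).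
    ideal_comb hI (z ** (q (t ** y) - t ** q y) + (z ** t - t ** z) ** q y).
exists J, (fun i => if i is 0%N then fun y => beta ** q y else fun y => - tau ** q y); split.
- split.
  + split=> [|y z [d hd] [e he]|c y [d hd]|c y [d hd]|c y [d hd]].
    * by exists 0; ideal_comb hI (0 : A).
    * by exists (d + e); ideal_comb hI ((alpha ** d - y) + (alpha ** e - z)).
    * by exists (c *: d); rewrite (algZr hA) -scalerBr; apply: (idealZ hI).
    * exists (c ** d).
      ideal_comb hI ((alpha ** c - c ** alpha) ** d + c ** (alpha ** d - y)).
    * by exists (d ** c); ideal_comb hI ((alpha ** d - y) ** c).
  + by move=> y iy; exists 0; ideal_comb hI (- y).
  + move=> y hy; apply: sI => z; apply: reg.
    have h : I (y ** (alpha ** (z ** y))) by apply: hy; exists (z ** y); ideal_comb hI (0 : A).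
    ideal_comb hI (y ** (alpha ** (z ** y)) + (alpha ** y - y ** alpha) ** z ** y).
  + move=> y hy; apply: sI => z; apply: reg.
    have h : I (alpha ** (y ** z) ** y) by apply: hy; exists (y ** z); ideal_comb hI (0 : A).
    ideal_comb hI (alpha ** (y ** z) ** y).
- case=> [|[|i]] // _; apply: bim => // y.
  ideal_comb hI (- (tau ** y - y ** tau)).
- move=> d /qP hd; rewrite 2!big_ord_recl big_ord0 /=.
  have h : I (q (x ** d) - x ** q d).
    by apply: qE; ideal_comb hI ((alpha ** x - x ** alpha) ** q d + x ** (alpha ** q d - d)).
  ideal_comb hI (- (x ** x ** (alpha ** q d - d)) - (alpha ** (x ** x) - (x ** x) ** alpha) ** q d
    + (alpha ** x ** x - tau ** x + beta) ** q d - tau ** (q (x ** d) - x ** q d)).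
Qed.

(** * Commuting skew elements force degree at most two *)

Section CommutingSkew.
Hypothesis hK : forall k h, skew k -> skew h -> I (k ** h - h ** k).

(** For symmetric s, the skew elements l and m s + s m commute modulo I, which gives [anti]; two
    instances of it add up to 2 [k h, s] modulo I. *)
Lemma skew_mul_central k h : skew k -> skew h -> central_mod (k ** h).
Proof.
move=> sk sh; apply: central_mod_ind => [s ss|g sg]; last first.
  ideal_comb hI (k ** (h ** g - g ** h) + (k ** g - g ** k) ** h).
have anti l m : skew l -> skew m ->
    I ((l ** s - s ** l) ** m + m ** (l ** s - s ** l)).
  move=> sl sm; have sms := skew_jordan sm ss.
  ideal_comb hI ((l ** (m ** s + s ** m) - (m ** s + s ** m) ** l)
    - s ** (l ** m - m ** l) - (l ** m - m ** l) ** s).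
apply: (ideal_divn hI h2).
have h1 := anti h k sh sk; have h2' := anti k h sk sh.
ideal_comb hI (((h ** s - s ** h) ** k + k ** (h ** s - s ** h))
  + ((k ** s - s ** k) ** h + h ** (k ** s - s ** k))
  + ((k ** h - h ** k) ** s - s ** (k ** h - h ** k))).
Qed.

(** Modulo I, for k skew and s symmetric, a k and a s a = a (a s + s a) are central with square
    zero. Both vanish, so a A a ⊆ I. *)
Lemma skew_sq_mem a : skew a -> I (a ** a) -> I a.
Proof.
move=> ska Iaa.
have ak k : skew k -> I (a ** k).
  move=> sk; have c := skew_mul_central ska sk; apply: (sI _) => x.
  ideal_comb hI (((a ** k) ** x - x ** (a ** k)) ** (a ** k)
    + x ** (a ** (k ** a - a ** k) ** k + (a ** a) ** k ** k)).
have asa s : s^* = s -> I (a ** s ** a).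
  move=> ss; have c := skew_mul_central ska (skew_jordan ska ss).
  apply: (sI _) => x.
  ideal_comb hI (((a ** (a ** s + s ** a)) ** x - x ** (a ** (a ** s + s ** a))) ** (a ** s ** a)
    - (a ** a) ** s ** x ** (a ** s ** a)
    + x ** ((a ** a) ** s ** a ** s ** a + a ** s ** (a ** a) ** s ** a)).
apply: (sI _) => x; have [s [k [ss sk ->]]] := sym_skew_decomp x.
have h1 := ak k sk; have h3 := asa s ss.
ideal_comb hI (a ** s ** a + a ** k ** a).
Qed.

Lemma commuting_skew_deg_le2 x : deg_le_mod mul I 2 x.
Proof.
have [hc|/existsNP[a /not_implyP[ska nca]]] := pselect (forall k, skew k -> central_mod k).
  exact: (commutative_deg_le1 (skew_central_commutative hc)).
have na : ~ I (a ** a).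
  move=> /(skew_sq_mem ska) ia; apply: nca => y.
  ideal_comb hI (a ** y - y ** a).
have aas : (a ** a)^* = a ** a by rewrite stE ska; ncring.
have caa := skew_mul_central ska ska.
have reg v : I (a ** a ** v) -> I v by apply: (central_mod_regular (or_introl _) _ _).
have [s [k [ss sk ->]]] := sym_skew_decomp x.
have ct := skew_mul_central ska (skew_jordan ska ss).
pose X := a ** s ** a ** s; pose Y := s ** a ** s ** a.
have Xa : I (a ** X - X ** a).
  rewrite /X.
  ideal_comb hI ((a ** (a ** s + s ** a)) ** (a ** s) - (a ** s) ** (a ** (a ** s + s ** a))).
(* Since a commutes with X and a l is central, a^2 [l, X] vanishes modulo I, and a^2 cancels. *)
have Xk l : skew l -> I (l ** X - X ** l).
  move=> sl; apply: reg; have c := skew_mul_central ska sl.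
  ideal_comb hI (a ** ((a ** l) ** X - X ** (a ** l)) - a ** (a ** X - X ** a) ** l).
have XY : I (X - Y).
  rewrite /X /Y.
  ideal_comb hI (((a ** (a ** s + s ** a)) ** s - s ** (a ** (a ** s + s ** a)))
    - ((a ** a) ** s - s ** (a ** a)) ** s).
(* Z is symmetric exactly, not just modulo I, so that [Z, t] is skew for symmetric t. *)
have [Z [Zs ZX]] : exists Z, Z^* = Z /\ I (X *+ 2 - Z).
  exists (X + Y); split; first by rewrite /X /Y !stE ss ska; ncring.
  ideal_comb hI (X - Y).
have Zk l : skew l -> I (Z ** l - l ** Z).
  move=> /Xk h.
  ideal_comb hI (- (l ** X - X ** l) *+ 2 - (X *+ 2 - Z) ** l + l ** (X *+ 2 - Z)).
have cX : central_mod X.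
  move=> y; apply: (ideal_divn hI h2).
  suff h : I (Z ** y - y ** Z).
    ideal_comb hI ((Z ** y - y ** Z) + (X *+ 2 - Z) ** y - y ** (X *+ 2 - Z)).
  apply: central_mod_ind y => // t st.
  have sy : skew (Z ** t - t ** Z) by rewrite /Defs.skew !stE st Zs; ncring.
  have h1 := Zk _ (skew_jordan ska st); have h3 := Zk _ ska.
  (* Modulo I, [Z, t] commutes with a, being skew, and anticommutes with a, because Z commutes with
     a t + t a and with a. *)
  apply: reg; apply: (ideal_divn hI h2).
  ideal_comb hI (a ** ((Z ** (a ** t + t ** a) - (a ** t + t ** a) ** Z)
    - (Z ** a - a ** Z) ** t - t ** (Z ** a - a ** Z)
    + (a ** (Z ** t - t ** Z) - (Z ** t - t ** Z) ** a))).
exists 2; split=> //.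
(* For x = s + k the quadratic expression collapses to a [a k, s], and a k is central modulo I. *)
apply: (central_quadratic_root (alpha := a ** a) (tau := a ** (a ** s + s ** a))
  (beta := X - a ** a ** (k ** k))) => //.
- have c := central_modM caa (skew_mul_central sk sk).
  move=> y; ideal_comb hI ((X ** y - y ** X) - ((a ** a ** (k ** k)) ** y - y ** (a ** a ** (k ** k)))).
- rewrite /X; have c := skew_mul_central ska sk.
  ideal_comb hI (a ** ((a ** k) ** s - s ** (a ** k))).
Qed.
End CommutingSkew.
End LowDegree.

(** * Derivations with zero cube *)

Section CubeZero.
Variables (Phi : comNzRingType) (A : lmodType Phi).
Variables (mul : A -> A -> A) (star : A -> A).
Hypotheses (h2 : exists u : Phi, u * 2%:R = 1) (h3 : exists u : Phi, u * 3%:R = 1).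
Hypotheses (hA : is_assoc_algebra mul) (hstar : is_involution mul star).
Local Notation "x ** y" := (mul x y) (at level 40, left associativity).
Local Notation "x ^*" := (star x) : ring_scope.
Local Notation skew := (Defs.skew star).
Let stE := starE hstar.

Variable d : A -> A.
Hypothesis hd : is_sder mul star d.

Lemma sderD x y : d (x + y) = d x + d y. Proof. by case: hd. Qed.
Lemma sderM x y : d (x ** y) = d x ** y + x ** d y. Proof. by case: hd. Qed.
Lemma sder_star x : d x^* = (d x)^*. Proof. by case: hd. Qed.
Lemma sderN x : d (- x) = - d x.
Proof. by case: hd => _ h _ _; rewrite -scaleN1r h scaleN1r. Qed.
Lemma sder0 : d 0 = 0.
Proof. by case: hd => _ h _ _; rewrite -[in LHS](scale0r (0 : A)) h scale0r. Qed.
Lemma sderMn x n : d (x *+ n) = d x *+ n.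
Proof. by case: hd => _ h _ _; rewrite -!scaler_nat h. Qed.
Definition sderE := (sderD, sderM, sderN, sder0, sderMn).

Lemma sder_skew k : skew k -> skew (d k).
Proof. by rewrite /Defs.skew -sder_star => ->; rewrite sderN. Qed.
(* Model: d = ad a with a a = 0 and a K a = 0 modulo W; then d (d x) = -2 a x a,
   and the alternating form S x z y := d x (d z) (d (d y)) stands for
   a x a z a y a up to a scalar. *)
Lemma sder_cube_zero_mod (W : A -> Prop) :
    is_ideal mul W -> semiprime_mod mul W -> (forall x, W (d (d (d x)))) ->
  (forall k, skew k -> d (d k) = 0) -> forall x, W (d x).
Proof.
move=> hW sW d3 d2K.
have es x : d (d x^*) = d (d x).
  apply/eqP; rewrite eq_sym -subr_eq0 -sderN -sderD -sderN -sderD.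
  by rewrite d2K //; apply: (skew_sub hA hstar).
have hAB x y : W (d (d x) ** d y + d x ** d (d y)).
  apply: (ideal_divn hW h3); have := d3 (x ** y); rewrite !sderE => h.
  have := d3 x; have := d3 y => hy hx.
  ideal_comb hW ((d (d (d x)) ** y + d (d x) ** d y + (d (d x) ** d y + d x ** d (d y)) +
    (d (d x) ** d y + d x ** d (d y) + (d x ** d (d y) + x ** d (d (d y)))))
    - d (d (d x)) ** y - x ** d (d (d y))).
have hB x y : W (d (d x) ** d (d y)).
  have := hAB x (d y); have := d3 y => hy h.
  ideal_comb hW ((d (d x) ** d (d y) + d x ** d (d (d y))) - d x ** d (d (d y))).
(* The invariance [es] of d^2 under the involution is applied to the product x (d y). *)
have hC x y : W (d x ** d (d y) + d y ** d (d x)).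
  have h1 := hAB x y; have hx := d3 x; have hy := d3 y; have hys := d3 y^*.
  have h4 := hAB y^* x^*; have h5 := hAB y x^*.
  have h := es (x ** d y); rewrite stE -sder_star !sderE !es in h; rewrite !es in h4 h5.
  have h6 := ideal_eq hW h.
  ideal_comb hW ((d (d y) ** d x^* + d y^* ** d (d x)) + (d (d y) ** d x^* + d y ** d (d x))
    - (d (d x) ** d y + d x ** d (d y)) + d (d (d y)) ** x^* - x ** d (d (d y))
    - (d (d (d y)) ** x^* + d (d y) ** d x^* + (d (d y) ** d x^* + d y^* ** d (d x))
     - (d (d x) ** d y + d x ** d (d y) + (d x ** d (d y) + x ** d (d (d y)))))).
have hD x y : W (d (d y) ** d x - d x ** d (d y)).
  have h1 := hAB y x; have h4 := hC x y.
  ideal_comb hW ((d (d y) ** d x + d y ** d (d x)) - (d x ** d (d y) + d y ** d (d x))).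
(* [hC] for x and y (d w) reduces to 2 (d x) (d y) (d^2 w) modulo W, the other terms being aligned
   by [hD], [hC] and [hAB]. *)
have hS x y w : W (d x ** d y ** d (d w)).
  apply: (ideal_divn hW h2); have := hC x (y ** d w); rewrite !sderE => h.
  have := hD w x; have := hD w y; have := hC x y; have := hC w y.
  have := hAB y w; have := hB w x; have := d3 w => *.
  ideal_comb hW ((d x ** (d (d y) ** d w + d y ** d (d w) + (d y ** d (d w) + y ** d (d (d w))))
      + (d y ** d w + y ** d (d w)) ** d (d x))
    - d x ** (d (d y) ** d w + d y ** d (d w)) - d x ** y ** d (d (d w)) - y ** (d (d w) ** d (d x))
    + d y ** (d (d x) ** d w - d w ** d (d x)) - (d x ** d (d y) + d y ** d (d x)) ** d w
    + d x ** (d (d y) ** d w - d w ** d (d y)) + d x ** (d w ** d (d y) + d y ** d (d w))).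
have he x : W (d (d x)).
  apply: (sW _) => z; have := hB (x ** z) x; rewrite !sderE => h.
  have := hS x z x; have := hB z x => *.
  ideal_comb hW ((d (d x) ** z + d x ** d z + (d x ** d z + x ** d (d z))) ** d (d x)
    - (d x ** d z ** d (d x)) *+ 2 - x ** (d (d z) ** d (d x))).
have hdd x y : W (d x ** d y).
  apply: (ideal_divn hW h2); have := he (x ** y); rewrite !sderE => h.
  have := he x; have := he y => *.
  ideal_comb hW ((d (d x) ** y + d x ** d y + (d x ** d y + x ** d (d y)))
    - d (d x) ** y - x ** d (d y)).
move=> x; apply: (sW _) => z.
have := hdd x (z ** x); rewrite sderE => h; have := hdd x z => *.
ideal_comb hW (d x ** (d z ** x + z ** d x) - (d x ** d z) ** x).
Qed.

End CubeZero.

(** * Derivations with zero square on skew elements *)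

Section SquareZero.
Variables (Phi : comNzRingType) (A : lmodType Phi).
Variables (mul : A -> A -> A) (star : A -> A).
Hypotheses (h2 : exists u : Phi, u * 2%:R = 1) (h3 : exists u : Phi, u * 3%:R = 1).
Hypotheses (hA : is_assoc_algebra mul) (hstar : is_involution mul star).
Local Notation "x ** y" := (mul x y) (at level 40, left associativity).
Local Notation "x ^*" := (star x) : ring_scope.
Local Notation skew := (Defs.skew star).
Let stE := starE hstar.

Hypothesis sA : forall c, (forall x, c ** x ** c = 0) -> c = 0.

(** Since x b y + y^* b x^* is skew, b x b y b changes sign when x and y are swapped. So b x b x b =
    0, and swapping x with y b x gives (b x b) y (b x b) = 0. *)
Lemma skew_sandwich_eq0 b :
  skew b -> (forall h, skew h -> b ** h ** b = 0) -> b = 0.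
Proof.
move=> sb hb.
have hs x : b ** x ** b - b ** x^* ** b = 0.
  by have h := hb _ (skew_sub hA hstar x); eq_lincomb (b ** (x - x^*) ** b).
have hanti x y : b ** x ** b ** y ** b = - (b ** y ** b ** x ** b).
  have sk : skew (x ** b ** y + y^* ** b ** x^*).
    by rewrite /Defs.skew !stE sb; ncring.
  have h := hb _ sk; have := hs x; have := hs y => *.
  eq_lincomb (b ** (x ** b ** y + y^* ** b ** x^*) ** b
    + (b ** y ** b - b ** y^* ** b) ** x ** b
    + b ** y^* ** (b ** x ** b - b ** x^* ** b)).
apply: (sA _) => x; apply: (sA _) => y; apply: (mulrn_eq0 h2).
have := hanti x (y ** b ** x); have := hanti x x => *.
eq_lincomb ((b ** x ** b ** (y ** b ** x) ** b - - (b ** (y ** b ** x) ** b ** x ** b)) *+ 2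
  - b ** y ** (b ** x ** b ** x ** b - - (b ** x ** b ** x ** b))).
Qed.

Variable d : A -> A.
Hypothesis hd : is_sder mul star d.
Hypothesis d2K : forall k, skew k -> d (d k) = 0.
Let dE := sderE hd.
Let dK k : skew k -> skew (d k) := sder_skew hd (k := k).

Let skew_triple k h : skew k -> skew h -> skew (k ** h ** k).
Proof. by rewrite /Defs.skew !stE => -> ->; ncring. Qed.

(** Half of d^2 (k h k) = 0; [hcomm] comes from [k, h] in the same way. *)
Let hquad k h : skew k -> skew h ->
  d k ** d h ** k + d k ** h ** d k + k ** d h ** d k = 0.
Proof.
move=> sk sh; apply: (mulrn_eq0 h2).
have e0 := d2K (skew_triple sk sh); rewrite !dE in e0.
eq_lincomb (((d (d k) ** h + d k ** d h + (d k ** d h + k ** d (d h))) ** k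
  + (d k ** h + k ** d h) ** d k
  + ((d k ** h + k ** d h) ** d k + k ** h ** d (d k)))
  - d (d k) ** h ** k - k ** d (d h) ** k - k ** h ** d (d k)).
Qed.

Let hcomm k h : skew k -> skew h -> d k ** d h - d h ** d k = 0.
Proof.
move=> sk sh; apply: (mulrn_eq0 h2).
have skh : skew (k ** h - h ** k) by rewrite /Defs.skew !stE sk sh; ncring.
have e0 := d2K skh; rewrite !dE in e0.
eq_lincomb ((d (d k) ** h + d k ** d h + (d k ** d h + k ** d (d h))
  - (d (d h) ** k + d h ** d k + (d h ** d k + h ** d (d k))))
  - d (d k) ** h - k ** d (d h) + d (d h) ** k + h ** d (d k)).
Qed.

(** Applying d to [hquad] gives three times this product. *)
Let haba k h : skew k -> skew h -> d k ** d h ** d k = 0.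
Proof.
move=> sk sh; apply: (mulrn_eq0 h3).
have := congr1 d (hquad sk sh); rewrite !dE => e0.
eq_lincomb (((d (d k) ** d h + d k ** d (d h)) ** k + d k ** d h ** d k
  + ((d (d k) ** h + d k ** d h) ** d k + d k ** h ** d (d k))
  + ((d k ** d h + k ** d (d h)) ** d k + k ** d h ** d (d k)))
  - d (d k) ** d h ** k - d k ** d (d h) ** k - d (d k) ** h ** d k
  - d k ** h ** d (d k) - k ** d (d h) ** d k - k ** d h ** d (d k)).
Qed.

Let hthree k h l : skew k -> skew h -> skew l -> d k ** d h ** d l = 0.
Proof.
have haab m n : skew m -> skew n -> d m ** d m ** d n = 0.
  move=> sm sn; have := haba sm sn; have := hcomm sm sn => *.
  eq_lincomb (d m ** d n ** d m + d m ** (d m ** d n - d n ** d m)).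
move=> sk sh sl; apply: (mulrn_eq0 h2).
have skh : skew (k + h) by rewrite /Defs.skew stE sk sh; ncring.
have := haab _ _ skh sl; rewrite !dE => e0.
have := haab _ _ sk sl; have := haab _ _ sh sl; have := hcomm sk sh => *.
eq_lincomb ((d k + d h) ** (d k + d h) ** d l - d k ** d k ** d l - d h ** d h ** d l
  + (d k ** d h - d h ** d k) ** d l).
Qed.

(** For the symmetric part s of x, (d l) s + s (d l) is skew because d l is, and [hthree] applies to
    its derivative. *)
Let hpdb k h l x : skew k -> skew h -> skew l -> d k ** d h ** d x ** d l = 0.
Proof.
move=> sk sh sl; have [s [n [ss sn ->]]] := sym_skew_decomp h2 hA hstar x.
have := hthree sk sh (skew_jordan hA hstar (dK sl) ss); rewrite !dE => e0.
have := hthree sk sh sl; have := hthree sk sh sn; have := d2K sl => *.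
eq_lincomb (d k ** d h ** (d (d l) ** s + d l ** d s + (d s ** d l + s ** d (d l)))
  - d k ** d h ** d (d l) ** s - d k ** d h ** d l ** d s
  - d k ** d h ** s ** d (d l) + d k ** d h ** d n ** d l).
Qed.

Let hpxbdb k h n l x y : skew k -> skew h -> skew n -> skew l ->
  d k ** d h ** x ** d n ** d y ** d l = 0.
Proof.
move=> sk sh sn sl; have := hpdb (x ** d n ** y) sk sh sl; rewrite !dE => e0.
have := hpdb x sk sh sn; have := d2K sn => *.
eq_lincomb (d k ** d h ** ((d x ** d n + x ** d (d n)) ** y + x ** d n ** d y) ** d l
  - d k ** d h ** d x ** d n ** y ** d l - d k ** d h ** x ** d (d n) ** y ** d l).
Qed.

Let hanti l s : skew l -> s^* = s -> d l ** d (d s) + d (d s) ** d l = 0.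
Proof.
move=> sl ss; have := d2K (skew_jordan hA hstar (dK sl) ss); rewrite !dE => e0.
have h' := d2K sl; have h'' := d2K (dK sl).
eq_lincomb ((d (d (d l)) ** s + d (d l) ** d s + (d (d l) ** d s + d l ** d (d s))
  + (d (d s) ** d l + d s ** d (d l) + (d s ** d (d l) + s ** d (d (d l)))))
  - d (d (d l)) ** s - (d (d l) ** d s) *+ 2 - (d s ** d (d l)) *+ 2 - s ** d (d (d l))).
Qed.

(** For symmetric s, d^2 s anticommutes with d k and d h, so it moves to the front; (d^2 s) (d k) (d
    h) vanishes by semiprimeness and [hpxbdb]. *)
Let hpe k h x : skew k -> skew h -> d k ** d h ** d (d x) = 0.
Proof.
move=> sk sh; have [s [n [ss sn ->]]] := sym_skew_decomp h2 hA hstar x.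
have hsp : d (d s) ** d k ** d h = 0.
  apply: (sA _) => y; have := hpxbdb y (d s) sk sh sk sh.
  have := hanti sk ss => *.
  eq_lincomb (d (d s) ** (d k ** d h ** y ** (d k ** d (d s) + d (d s) ** d k) ** d h
    - d k ** d h ** y ** d k ** d (d s) ** d h)).
have := hanti sk ss; have := hanti sh ss; have := d2K sn; rewrite !dE => *.
eq_lincomb (d k ** (d h ** d (d s) + d (d s) ** d h)
  - (d k ** d (d s) + d (d s) ** d k) ** d h + d (d s) ** d k ** d h + d k ** d h ** d (d n)).
Qed.

(** The product p = (d k) (d h) kills d^2 A, so d^2 (u v) yields 2 p (d u) (d v) + p u (d^2 v) = 0.
    The pairs (x, d y) and (d x, y) give the claim. *)
Let hpd3 k h x y : skew k -> skew h -> d k ** d h ** x ** d (d (d y)) = 0.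
Proof.
move=> sk sh.
have hxy u v : (d k ** d h ** d u ** d v) *+ 2 + d k ** d h ** u ** d (d v) = 0.
  have := hpe (u ** v) sk sh; rewrite !dE => e0; have := hpe u sk sh => *.
  eq_lincomb (d k ** d h ** (d (d u) ** v + d u ** d v + (d u ** d v + u ** d (d v)))
    - d k ** d h ** d (d u) ** v).
have := hxy x (d y); have := hxy (d x) y; have := hpe x sk sh => *.
eq_lincomb ((d k ** d h ** d x ** d (d y)) *+ 2 + d k ** d h ** x ** d (d (d y))
  - ((d k ** d h ** d (d x) ** d y) *+ 2 + d k ** d h ** d x ** d (d y)) *+ 2
  + (d k ** d h ** d (d x) ** d y) *+ 4).
Qed.

Let hprod0 k h : skew k -> skew h -> d k ** d h = 0.
Proof.
move=> sk0 sh0.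
(* This right annihilator is a semiprime ideal containing d^3 A, so [sder_cube_zero_mod] puts d A
   into it. *)
pose W x := forall k h y, skew k -> skew h -> d k ** d h ** y ** x = 0.
have hW : is_ideal mul W.
  split=> [|x y hx hy|c x hx|c x hx|c x hx] l m z sl sm.
  - by rewrite (alg0r hA).
  - by rewrite (algDr hA) hx // hy // addr0.
  - by rewrite (algZr hA) hx // scaler0.
  - by have h' := hx l m (z ** c) sl sm; eq_lincomb (d l ** d m ** (z ** c) ** x).
  - by have h' := hx l m z sl sm; eq_lincomb (d l ** d m ** z ** x ** c).
have sW : semiprime_mod mul W.
  move=> c hc l m z sl sm; apply: (sA _) => t.
  have := hc (t ** d l ** d m ** z) l m z sl sm => e0.
  eq_lincomb (d l ** d m ** z ** (c ** (t ** d l ** d m ** z) ** c)).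
have dW : forall x, W (d x).
  apply: (sder_cube_zero_mod h2 h3 hA hstar hd hW sW) => // x l m z sl sm.
  exact: hpd3.
apply: (sA _) => x; have := dW k k h x sk0 sh0 => *.
eq_lincomb (d k ** d h ** x ** d k ** d h).
Qed.

Lemma sder_sq_zero_skew k : skew k -> d k = 0.
Proof.
move=> sk; apply: skew_sandwich_eq0; first exact: dK.
move=> h sh; have := hquad sk sh; have := hprod0 sk sh; have := hprod0 sh sk => *.
eq_lincomb (d k ** d h ** k + d k ** h ** d k + k ** d h ** d k
  - d k ** d h ** k - k ** (d h ** d k)).
Qed.

End SquareZero.

(** * Absolute zero divisors of the derivation algebra *)

Section HighDegree.
Variables (Phi : comNzRingType) (A : lmodType Phi).
Variables (mul : A -> A -> A) (star : A -> A).
Hypotheses (h2 : exists u : Phi, u * 2%:R = 1) (h3 : exists u : Phi, u * 3%:R = 1).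
Hypotheses (hA : is_assoc_algebra mul) (hstar : is_involution mul star).
Hypothesis hsemi : star_semiprime mul star.
Hypothesis hdeg :
  forall I : A -> Prop, star_prime_ideal mul star I -> deg_gt_mod mul I 2.
Local Notation "x ** y" := (mul x y) (at level 40, left associativity).
Local Notation "x ^*" := (star x) : ring_scope.
Local Notation skew := (Defs.skew star).
Local Notation central := (Defs.central mul).
Let stE := starE hstar.
Let sA := star_semiprime_elt hA hstar hsemi.

Lemma skew_comm k h : skew k -> skew h -> skew (k ** h - h ** k).
Proof. by rewrite /Defs.skew !stE => -> ->; ncring. Qed.

(** A *-prime ideal I avoiding a non-zero u would contain all [k, h], and every element of A/I would
    have degree at most two. *)
Lemma skew_comm_annihilator u :
  (forall k h x, skew k -> skew h -> (k ** h - h ** k) ** x ** u = 0) -> u = 0.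
Proof.
move=> hu; apply: contrapT => /(star_prime_avoid hA hstar hsemi)[I [pI nu]].
have [x nx] := hdeg pI; apply: nx.
apply: (commuting_skew_deg_le2 h2 hA hstar pI) => k h sk sh.
have sc := skew_comm sk sh; have I0 : I 0 by case: pI => [[[]]].
have [||//|//] := star_prime_ideal_elt hA hstar (u := k ** h - h ** k) (v := u) pI (or_intror sc).
  by move=> y; rewrite hu.
(* The star of the hypothesis says that u^* z [k, h] = 0, a factor of the sandwich of z by [k, h] y
   u^*. *)
move=> y; rewrite (_ : _ ** u^* = 0) //; apply: (sA _) => z.
have := congr1 star (hu k h z^* sk sh); rewrite !stE sk sh => e0.
eq_lincomb (- ((k ** h - h ** k) ** y ** (u^* ** (z ** (- h ** - k - - k ** - h))) ** y ** u^*)).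
Qed.

(** For symmetric s, d s anticommutes with every skew element. So it commutes with k h and h k but
    anticommutes with [k, h], whence [k, h] (d s) = 0. *)
Lemma sder_eq0 d : is_sder mul star d -> (forall k, skew k -> d k = 0) ->
  forall x, d x = 0.
Proof.
move=> hd d0.
have hkill x k h : skew k -> skew h -> (k ** h - h ** k) ** d x = 0.
  move=> sk sh; have [s [n [ss sn ->]]] := sym_skew_decomp h2 hA hstar x.
  have anti l : skew l -> l ** d s + d s ** l = 0.
    move=> sl; have := d0 _ (skew_jordan hA hstar sl ss); rewrite !(sderE hd).
    have := d0 _ sl => *.
    eq_lincomb (d l ** s + l ** d s + (d s ** l + s ** d l) - d l ** s - s ** d l).
  apply: (mulrn_eq0 h2); rewrite (sderE hd).
  have := d0 _ sn; have := anti _ sk; have := anti _ sh.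
  have := anti _ (skew_comm sk sh) => *.
  eq_lincomb (((k ** h - h ** k) ** d s + d s ** (k ** h - h ** k))
    + k ** (h ** d s + d s ** h) - (k ** d s + d s ** k) ** h
    - h ** (k ** d s + d s ** k) + (h ** d s + d s ** h) ** k
    + ((k ** h - h ** k) ** d n) *+ 2).
move=> x; apply: skew_comm_annihilator => k h y sk sh.
have := hkill (y ** x) k h sk sh; have := hkill y k h sk sh.
rewrite (sderE hd) => *.
eq_lincomb ((k ** h - h ** k) ** (d y ** x + y ** d x) - (k ** h - h ** k) ** d y ** x).
Qed.

Lemma inner_sder k : skew k -> is_sder mul star (fun x => k ** x - x ** k).
Proof.
move=> sk; split=> [x y|c x|x y|x].
- by ncring.
- by rewrite (algZl hA) (algZr hA) scalerBr.
- by ncring.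
- by rewrite !stE sk; ncring.
Qed.

Lemma central_nilpotent z : central z -> z ** z ** z = 0 -> z = 0.
Proof.
move=> cz z3.
have z2 : z ** z = 0.
  apply: (sA _) => x.
  eq_lincomb (z ** z ** (x ** z - z ** x) ** z + z ** z ** z ** x ** z).
apply: (sA _) => x; eq_lincomb (z ** (x ** z - z ** x) + z ** z ** x).
Qed.

Lemma centralD x y : central x -> central y -> central (x + y).
Proof. by move=> cx cy z; rewrite (algDl hA) (algDr hA) cx cy. Qed.
Lemma centralN x : central x -> central (- x).
Proof. by move=> cx z; rewrite (algNl hA) (algNr hA) cx. Qed.
Lemma centralM x y : central x -> central y -> central (x ** y).
Proof. by move=> cx cy z; rewrite -(algA hA) cy (algA hA) cx (algA hA). Qed.

Lemma central_half x : central (x *+ 2) -> central x.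
Proof.
move=> c z; apply/subr0_eq; apply: (mulrn_eq0 h2).
eq_lincomb (x *+ 2 ** z - z ** (x *+ 2)).
Qed.

Lemma central_annihilator c : central c ->
  (forall k x, skew k -> c ** (k ** x - x ** k) = 0) -> c = 0.
Proof.
move=> cc hc; apply: skew_comm_annihilator => k h x sk sh.
have := hc k h sk => *.
eq_lincomb ((k ** h - h ** k) ** (x ** c - c ** x)
  - (c ** (k ** h - h ** k) - (k ** h - h ** k) ** c) ** x
  + c ** (k ** h - h ** k) ** x).
Qed.

(** With z = [a, k] central, [a, a k a] = z a^2 is central. Its commutator with k gives z^2 a = 0,
    and that of z^2 a gives z^3 = 0. So the inner derivation of a vanishes on K, hence
    everywhere. *)
Lemma skew_central a : skew a ->
  (forall k, skew k -> central (a ** k - k ** a)) -> central a.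
Proof.
move=> sa ca.
have comm0 k : skew k -> a ** k - k ** a = 0.
  move=> sk; have := ca k sk; set z := a ** k - k ** a => cz.
  have zza : z ** z ** a = 0.
    apply: (mulrn_eq0 h2).
    have saka : skew (a ** k ** a) by rewrite /Defs.skew !stE sa sk; ncring.
    have := ca _ saka k => e0.
    have e1 : a ** z ** a ** k - k ** (a ** z ** a) = 0.
      rewrite /z; eq_lincomb ((a ** (a ** k ** a) - a ** k ** a ** a) ** k
        - k ** (a ** (a ** k ** a) - a ** k ** a ** a)).
    have e2 : a ** a ** k - k ** a ** a - a ** z - z ** a = 0 by rewrite /z; ncring.
    eq_lincomb ((a ** z ** a ** k - k ** (a ** z ** a)) + (z ** a - a ** z) ** a ** k
      - (z ** (k ** a) - (k ** a) ** z) ** a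
      - z ** (a ** a ** k - k ** a ** a - a ** z - z ** a)
      + z ** (z ** a - a ** z)).
  apply: central_nilpotent => //.
  have e2 : a ** k - k ** a - z = 0 by rewrite /z subrr.
  eq_lincomb (z ** z ** a ** k - k ** (z ** z ** a)
    - z ** z ** (a ** k - k ** a - z)
    - z ** (z ** k - k ** z) ** a - (z ** k - k ** z) ** z ** a).
by move=> x; apply: subr0_eq; apply: (sder_eq0 (inner_sder sa)).
Qed.

(** * Derivations whose square maps K into the center *)

Section SquareCentral.
Variable d : A -> A.
Hypothesis hd : is_sder mul star d.
Hypothesis d2K : forall k, skew k -> central (d (d k)).
Let dE := sderE hd.
Let dK k : skew k -> skew (d k) := sder_skew hd (k := k).

Lemma sder_central z : central z -> central (d z).
Proof.
move=> cz x; have := congr1 d (cz x); rewrite !dE => e0.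
eq_lincomb ((d z ** x + z ** d x - (d x ** z + x ** d z)) - (z ** d x - d x ** z)).
Qed.

(** The central element d^2 (y^2 k) - 2 y d^2 (y k) + y^2 d^2 k equals 2 (d y)^2 k. So (d y)^2
    annihilates [K, A] and vanishes. *)
Let sym_central_const y : y^* = y -> central y -> d y = 0.
Proof.
move=> sy cy; have cy' := sder_central cy.
have sM w k : w^* = w -> central w -> skew k -> skew (w ** k).
  by move=> sw cw; rewrite /Defs.skew stE sw cw => ->; ncring.
suff y2 : d y ** d y = 0.
  by apply: central_nilpotent => //; rewrite y2 (alg0l hA).
apply: central_annihilator; first exact: centralM.
move=> k x sk.
have c1 := d2K (sM _ _ sy cy sk).
have c2 : central (d (d (y ** y ** k))).
  by apply/d2K/sM => //; [rewrite stE sy|apply: centralM].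
have c : central (d y ** d y ** k).
  apply: central_half.
  have -> : (d y ** d y ** k) *+ 2 = d (d (y ** y ** k))
      + (- (y ** d (d (y ** k))) + - (y ** d (d (y ** k)))) + y ** y ** d (d k).
    rewrite !dE; eq_lincomb ((y ** d (d y) - d (d y) ** y) ** k
      + ((y ** d y - d y ** y) ** d k) *+ 2).
  apply: centralD; last by apply: centralM; [apply: centralM|apply: d2K].
  by apply: centralD => //; apply: centralD; apply: centralN; apply: centralM.
have cc := centralM cy' cy'.
eq_lincomb ((d y ** d y ** k ** x - x ** (d y ** d y ** k))
  - (d y ** d y ** x - x ** (d y ** d y)) ** k).
Qed.

(** As z^2 is symmetric, z (d z) = 0; differentiating and multiplying by d z gives (d z)^3 = 0. *)
Let skew_central_const z : skew z -> central z -> d z = 0.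
Proof.
move=> sz cz; have cz' := sder_central cz.
have zz' : z ** d z = 0.
  apply: (mulrn_eq0 h2).
  have : d (z ** z) = 0.
    apply: sym_central_const; last exact: centralM.
    by rewrite stE sz; ncring.
  rewrite dE => e0; eq_lincomb (d z ** z + z ** d z + (z ** d z - d z ** z)).
apply: central_nilpotent => //.
have := congr1 d zz'; rewrite !dE => e0.
eq_lincomb (d z ** (d z ** d z + z ** d (d z)) + (z ** d z - d z ** z) ** d (d z)
  - z ** d z ** d (d z)).
Qed.

(** Since d a = 0, d commutes with multiplication by a. Then d^3 (a k^2) = 6 a^2 (d k) is the
    derivative of a central skew element, hence zero, and one more d gives a^3 = 0. *)
Lemma sder_sq_skew_eq0 k : skew k -> d (d k) = 0.
Proof.
move=> sk; set a := d (d k); have sa : skew a := dK (dK sk); have ca := d2K sk.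
have da : d a = 0 by apply: skew_central_const.
have daM x : d (a ** x) = a ** d x by rewrite dE da (alg0l hA) add0r.
have sakk : skew (a ** k ** k).
  by rewrite /Defs.skew !stE sa sk; eq_lincomb (a ** (k ** k) - k ** k ** a).
have : d (d (d (a ** (k ** k)))) = 0.
  by apply: skew_central_const; [do 2 apply: dK|apply: d2K]; rewrite (algA hA).
rewrite !daM !dE -/a da => e0.
have aab : a ** a ** d k = 0.
  apply: (mulrn_eq0 h3); apply: (mulrn_eq0 h2).
  eq_lincomb (a ** (0 ** k + a ** d k + (a ** d k + d k ** a)
    + (a ** d k + d k ** a + (d k ** a + k ** 0))) + (a ** (a ** d k - d k ** a)) *+ 3).
apply: central_nilpotent => //.
by have := congr1 d aab; rewrite -!(algA hA) !daM -/a (sder0 hd).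
Qed.

End SquareCentral.

Lemma sder_absolute_zero_divisor d : is_sder mul star d ->
  (forall e, is_sder mul star e ->
     forall k, skew k -> central (lie_br d (lie_br d e) k)) ->
  forall x, d x = 0.
Proof.
move=> hd hz; apply: sder_eq0 => //; apply: (sder_sq_zero_skew h2 h3 hA hstar sA hd).
apply: (sder_sq_skew_eq0 hd) => k sk.
apply: skew_central; first by do 2 apply: (sder_skew hd).
(* For e = ad k, the double bracket [d, [d, e]] is ad (d^2 k). *)
move=> h sh; have := hz _ (inner_sder sk) h sh; rewrite /lie_br.
by congr central; rewrite !(sderE hd); ncring.
Qed.

End HighDegree.

Theorem theorem2p8 (Phi : comNzRingType) (A : lmodType Phi)
  (mul : A -> A -> A) (star : A -> A)
  (h2 : exists u : Phi, u * 2%:R = 1) (h3 : exists u : Phi, u * 3%:R = 1)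
  (hA : is_assoc_algebra mul) (hstar : is_involution mul star)
  (hsemi : star_semiprime mul star) (hnc : noncommutative mul)
  (hdeg : forall I : A -> Prop, star_prime_ideal mul star I ->
            deg_gt_mod mul I 2) :
  (* (i) SDer(A)/I_{K,Z} is strongly non-degenerate *)
  (forall d : A -> A, is_sder mul star d ->
     (forall e : A -> A, is_sder mul star e ->
        in_IKZ mul star (lie_br d (lie_br d e))) ->
     in_IKZ mul star d)
  /\
  (* (ii) if Z(K) contains no non-zero *-ideal of A, SDer(A) is strongly
     non-degenerate *)
  ((forall J : A -> Prop, is_star_ideal mul star J ->
      (forall x, J x -> lie_center_K mul star x) -> forall x, J x -> x = 0) ->
   forall d : A -> A, is_sder mul star d ->
     (forall e : A -> A, is_sder mul star e ->
        forall x, lie_br d (lie_br d e) x = 0) ->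
     forall x, d x = 0).
Proof.
have main := sder_absolute_zero_divisor h2 h3 hA hstar hsemi hdeg.
split=> [d hd hz|_ d hd hz].
- split=> // k sk y; rewrite (main d) ?(alg0l hA) ?(alg0r hA) //.
  by move=> e /hz[].
- apply: main => // e he k sk y.
  by rewrite hz // (alg0l hA) (alg0r hA).
Qed.
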